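(* Let $p$ be an odd prime and let $a$ be a positive integer. If $p\equiv 1\pmod 4$ or $a>1$, then $$\sum_{k=0}^{\lfloor \frac34 p^a\rfloor}\binom{-1/2}{k}\equiv\left(\frac{2}{p^a}\right)\pmod{p^2},$$ where $\left(\frac{\cdot}{\cdot}\right)$ denotes the Jacobi symbol.
   Context: $\binom{x}{k}=x(x-1)\cdots(x-k+1)/k!$ is the generalized binomial coefficient; in particular $\binom{-1/2}{k}=\binom{2k}{k}/(-4)^k$. The congruence is between rational numbers whose denominators are prime to $p$: $x\equiv y\pmod{p^2}$ means $x-y\in p^2\mathbb{Z}_{(p)}$, where $\mathbb{Z}_{(p)}$ is the ring of rational numbers with denominator prime to $p$. *)

(* Defs.v *)
From mathcomp Require Import all_boot all_order all_algebra.

Set Implicit Arguments.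
Unset Strict Implicit.
Unset Printing Implicit Defensive.

Import GRing.Theory.
Local Open Scope ring_scope.

Definition gbinom (x : rat) (k : nat) : rat :=
  (\prod_(i < k) (x - i%:R)) / (k`!)%:R.

(* The subring Z_(p) of rat, for p prime; [denq x] is the positive denominator of x in
   lowest terms. *)
Definition Zloc (p : nat) : pred rat := fun x => coprime p `|denq x|%N.

(* x = y modulo p ^ n Z_(p). *)
Definition eqmod_Zloc (p n : nat) (x y : rat) : Prop :=
  exists2 z : rat, z \in Zloc p & x - y = p%:R ^+ n * z.

(* Meaningful for p an odd prime. *)
Definition legendre (m : int) (p : nat) : int :=
  if (p%:Z %| m)%Z then 0
  else if [exists x : 'I_p, ((x : nat)%:Z ^+ 2 == m %[mod p%:Z])%Z] then 1
  else -1.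

(* Meaningful for n odd and positive; the product runs over the pairs
   (q, e) with q prime and e > 0 the exponent of q in n. *)
Definition jacobi (m : int) (n : nat) : int :=
  \prod_(f <- prime_decomp n) legendre m f.1 ^+ f.2.

(* Main.v *)
(* Put n = p^a, m = (n-1)/2, y = n/2, so that -1/2 = m - y, and work modulo p^2 Z_(p);
   n/t lies in p Z_(p) for 0 < t < n.
   For k <= m: the sums g(M) = sum_(k <= M) C(M - y, k) satisfy
   g(M+1) = 2 g(M) + C(M - y, M + 1), and C(M - y, M + 1) == - y / (M + 1), whence
   g(m) == 2^m (1 - sum_(j = 1..m) y / (j 2^j)).
   For k = m + 1 + i: C(-1/2, k) == (n/2) / (m C(m-1, i)), which is symmetric under
   i -> m - 1 - i. The bound floor(3n/4) cuts the range 0 <= i < m in half, up to a middle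
   term when n = 3 mod 4, which vanishes by Legendre's formula because then a > 1. The full
   sum is given by 2^m sum_(i < m) 1 / (m C(m-1, i)) = sum_(j = 1..m) 2^j / j.
   The two harmonic-like sums are related by the same evaluation of g with y = n and
   M = n - 1, where g = sum (-1)^k = 1. What remains is that 2^m == (2/n) mod p, by Euler. *)
From HB Require Import structures.
Require Import Defs.
From mathcomp Require Import all_boot all_order all_algebra all_field.
From mathcomp Require Import ring zify.

Set Implicit Arguments.
Unset Strict Implicit.
Unset Printing Implicit Defensive.

Import GRing.Theory Num.Theory Order.TTheory.
Local Open Scope ring_scope.

(** * The ring $\mathbb{Z}_{(p)}$ and its ideals $p^n\mathbb{Z}_{(p)}$ inside the rationals *)

(** The reduced denominator divides every [d] that clears [x], so no fraction has to be put in
    lowest terms below. *)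
Lemma Zloc_frac (p d : nat) (x : rat) (n : int) :
  coprime p d -> x * d%:R = n%:~R -> x \in Zloc p.
Proof.
move=> cpd xdn; rewrite unfold_in.
have e : (numq x * d%:Z)%R = (n * denq x)%R.
  apply/(@intr_inj rat); rewrite !rmorphM /= -xdn.
  by rewrite -{2}(divq_num_den x) mulrAC divfK ?intr_eq0 ?denq_neq0.
have /dvdzP dd : exists k, numq x * d%:Z = k * denq x by exists n.
have : (denq x %| d%:Z)%Z
  by rewrite -(@Gauss_dvdzr _ (numq x)) // /coprimez gcdzC; exact: coprime_num_den.
by rewrite dvdzE /= => /coprime_dvdr; apply.
Qed.

Lemma Zloc_subring (p : nat) : subring_closed (Zloc p).
Proof.
have dE (x : rat) : x * `|denq x|%N%:R = (numq x)%:~R.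
  have -> : (`|denq x|%N%:R : rat) = (denq x)%:~R by rewrite pmulrn absz_denq.
  by rewrite -{1}(divq_num_den x) divfK ?intr_eq0 ?denq_neq0.
split=> [|x y Px Py|x y Px Py].
- by rewrite unfold_in coprimen1.
- apply: (@Zloc_frac p (`|denq x| * `|denq y|) _ (numq x * denq y - numq y * denq x)).
    by rewrite coprimeMr; apply/andP.
  have dq (z : rat) : (denq z)%:~R = `|denq z|%N%:R :> rat by rewrite pmulrn absz_denq.
  by rewrite natrM rmorphB !rmorphM /= -!dE !dq; ring.
- apply: (@Zloc_frac p (`|denq x| * `|denq y|) _ (numq x * numq y)).
    by rewrite coprimeMr; apply/andP.
  by rewrite natrM rmorphM /= -!dE; ring.
Qed.
HB.instance Definition _ p := GRing.isSubringClosed.Build rat (Zloc p) (Zloc_subring p).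

Lemma Zloc_div (p d : nat) (x : int) : coprime p d -> x%:~R / d%:R \in Zloc p.
Proof.
(* For [d = 0] the quotient is 0 by the convention on inverses. *)
have [->|d0] := posnP d; first by rewrite invr0 mulr0 rpred0.
by move=> /Zloc_frac; apply; rewrite divfK // pnatr_eq0 -lt0n.
Qed.

Lemma Zloc_half (p : nat) : odd p -> 2^-1 \in Zloc p.
Proof.
move=> op; have := @Zloc_div p 2 1; rewrite mul1r; apply.
by rewrite coprimen2.
Qed.

(* The fractional ideal p ^ n Z_(p) of rat. *)
Definition Zpow (p n : nat) : {pred rat} := fun x => x / p%:R ^+ n \in Zloc p.

Lemma ZpowE (p n : nat) x : (x \in Zpow p n) = (x / p%:R ^+ n \in Zloc p).
Proof. by []. Qed.

Lemma Zpow_zmod (p n : nat) : zmod_closed (Zpow p n).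
Proof.
split=> [|x y]; rewrite !ZpowE; first by rewrite mul0r rpred0.
by rewrite mulrBl; apply: rpredB.
Qed.
HB.instance Definition _ p n := GRing.isZmodClosed.Build rat (Zpow p n) (Zpow_zmod p n).

Lemma ZpowM (p i j : nat) x y :
  x \in Zpow p i -> y \in Zpow p j -> x * y \in Zpow p (i + j).
Proof.
rewrite !ZpowE => hx hy; rewrite exprD invfM mulrACA; exact: rpredM.
Qed.

Lemma Zpow0 (p : nat) x : (x \in Zpow p 0) = (x \in Zloc p).
Proof. by rewrite ZpowE expr0 divr1. Qed.

Lemma ZpowMl (p i : nat) x y : x \in Zloc p -> y \in Zpow p i -> x * y \in Zpow p i.
Proof. by rewrite -Zpow0; apply: ZpowM. Qed.

Lemma ZpowMr (p i : nat) x y : x \in Zpow p i -> y \in Zloc p -> x * y \in Zpow p i.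
Proof. by move=> hx hy; rewrite mulrC ZpowMl. Qed.

Lemma ZpowS (p i : nat) x : (0 < p)%N -> x \in Zpow p i.+1 -> x \in Zpow p i.
Proof.
move=> p0; rewrite !ZpowE => /(rpredM (rpred_nat _ p : p%:R \in Zloc p)).
have p0' : p%:R != 0 :> rat by rewrite pnatr_eq0 -lt0n.
by rewrite exprS invfM mulrCA mulVKf.
Qed.

Lemma Zpow1_Zloc (p : nat) x : (0 < p)%N -> x \in Zpow p 1 -> x \in Zloc p.
Proof. by rewrite -Zpow0; apply: ZpowS. Qed.

Lemma ZpowP (p n : nat) x y : (0 < p)%N -> x - y \in Zpow p n -> eqmod_Zloc p n x y.
Proof.
move=> p0 h; exists ((x - y) / p%:R ^+ n) => //.
by rewrite mulrCA divff ?mulr1 // expf_neq0 // pnatr_eq0 -lt0n.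
Qed.

Lemma Zpow_int (p : nat) (x : int) : (0 < p)%N -> (p %| x)%Z -> x%:~R \in Zpow p 1.
Proof.
move=> p0 /dvdzP[k ->]; rewrite ZpowE expr1 rmorphM /= mulfK ?rpred_int //.
by rewrite intr_eq0 -lt0n.
Qed.

Lemma Zpow_invn (p a e q : nat) : prime p -> (0 < q)%N -> (logn p q + e <= a)%N ->
  (p ^ a)%:R / q%:R \in Zpow p e.
Proof.
move=> pp q0 le; have [p0 /negPf np] := (prime_gt0 pp, pp).
have p0' : p%:R != 0 :> rat by rewrite pnatr_eq0 -lt0n.
have [d cd qE] := pfactor_coprime pp q0.
rewrite ZpowE {1}qE natrM !natrX.
set l := logn p q in le *.
have -> : (p%:R : rat) ^+ a = p%:R ^+ (a - l - e) * p%:R ^+ e * p%:R ^+ l.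
  by rewrite -!exprD; congr (_ ^+ _); lia.
have d0 : d%:R != 0 :> rat.
  by rewrite pnatr_eq0; apply: contraTneq q0 => d0; rewrite qE d0 mul0n.
have -> : p%:R ^+ (a - l - e) * p%:R ^+ e * p%:R ^+ l / (d%:R * p%:R ^+ l) / p%:R ^+ e
  = p%:R ^+ (a - l - e) * (1%:~R / d%:R) :> rat.
  have := expf_neq0 e p0'; have := expf_neq0 l p0'.
  move: (_ ^+ e) (_ ^+ l) => u v v0 u0; field.
  by rewrite d0 u0.
by rewrite rpredM ?rpredX ?rpred_nat // Zloc_div.
Qed.

Lemma one_modM (p : nat) x y : (0 < p)%N ->
  x - 1 \in Zpow p 1 -> y - 1 \in Zpow p 1 -> x * y - 1 \in Zpow p 1.
Proof.
move=> p0 hx hy; have -> : x * y - 1 = (x - 1) * (y - 1) + (x - 1) + (y - 1) by ring.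
apply: rpredD => //; apply: rpredD => //.
by apply: ZpowMr => //; apply: Zpow1_Zloc.
Qed.

Lemma one_mod_prod (p m : nat) (f : nat -> rat) : (0 < p)%N ->
  (forall i, (i < m)%N -> f i - 1 \in Zpow p 1) ->
  \prod_(0 <= i < m) f i - 1 \in Zpow p 1.
Proof.
move=> p0; elim: m => [|m IH] h; first by rewrite big_nil subrr rpred0.
rewrite big_nat_recr //=; apply: one_modM; rewrite ?h //.
by apply: IH => i im; apply: h; apply: ltnW.
Qed.

(** * Generalized binomial coefficients and their partial sums *)

Lemma natS_neq0 (k : nat) : k.+1%:R != 0 :> rat.
Proof. by rewrite pnatr_eq0. Qed.

Lemma gbinom0 x : gbinom x 0 = 1.
Proof. by rewrite /gbinom big_ord0 fact0 divr1. Qed.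

Lemma gbinomS x k : gbinom x k.+1 = gbinom x k * ((x - k%:R) / k.+1%:R).
Proof.
by rewrite /gbinom big_ord_recr factS natrM invfM /=; ring.
Qed.

Lemma gbinom_absorb x k : gbinom (x + 1) k.+1 = (x + 1) / k.+1%:R * gbinom x k.
Proof.
elim: k => [|k IH]; first by rewrite gbinomS !gbinom0 subr0 mul1r mulr1.
rewrite gbinomS IH gbinomS.
have := natS_neq0 k; have := natS_neq0 k.+1; rewrite -!natr1 => h1 h2.
by field; rewrite h1 h2.
Qed.

Lemma gbinom_pascal x k : gbinom (x + 1) k.+1 = gbinom x k.+1 + gbinom x k.
Proof.
rewrite gbinom_absorb gbinomS;
by have := natS_neq0 k; rewrite -natr1 => h; field.
Qed.

(** Absorption lowers both indices by one and leaves the factor $(m-y)/m$. The product form shows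
    that the coefficient is 1 modulo $p$ once all $y/t$ lie in $p\mathbb{Z}_{(p)}$. *)
Lemma gbinom_shift_diag y m :
  gbinom (m%:R - y) m = \prod_(0 <= t < m) (1 - y / t.+1%:R).
Proof.
elim: m => [|m IH]; first by rewrite gbinom0 big_nil.
rewrite big_nat_recr //= -IH -natr1 addrAC gbinom_absorb mulrC.
by have := natS_neq0 m; rewrite -natr1 => h; congr (_ * _); field.
Qed.

Lemma gbinom_partial_sum_rec y m :
  \sum_(0 <= k < m.+2) gbinom (m.+1%:R - y) k =
  2 * (\sum_(0 <= k < m.+1) gbinom (m%:R - y) k) + gbinom (m%:R - y) m.+1.
Proof.
rewrite big_nat_recl // gbinom0 -natr1 addrAC.
under eq_bigr => k _ do rewrite gbinom_pascal.
rewrite big_split /= [X in _ + (X + _)]big_nat_recr //=.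
have -> : \sum_(0 <= k < m.+1) gbinom (m%:R - y) k =
   1 + \sum_(0 <= i < m) gbinom (m%:R - y) i.+1 by rewrite big_nat_recl // gbinom0.
ring.
Qed.

Lemma gbinom_partial_sum_mod (p m : nat) y : (0 < p)%N ->
  (forall t, (t < m)%N -> y / t.+1%:R \in Zpow p 1) ->
  \sum_(0 <= k < m.+1) gbinom (m%:R - y) k
    - 2 ^+ m * (1 - \sum_(0 <= j < m) y / j.+1%:R / 2 ^+ j.+1) \in Zpow p 2.
Proof.
move=> p0; elim: m => [|m IH] h.
  by rewrite big_nat1 big_nil gbinom0 subr0 mulr1 subrr rpred0.
have {}IH := IH (fun t tm => h t (ltnW tm)).
rewrite gbinom_partial_sum_rec gbinomS gbinom_shift_diag.
set S := \sum_(0 <= k < m.+1) _ in IH *; rewrite big_nat_recr //=;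
set T := \sum_(0 <= j < m) _ in IH *.
set P := \prod_(0 <= t < m) _.
(* Replacing [P] by 1 costs [(P - 1) * (y / m.+1%:R)], a product of two elements of
   $p\mathbb{Z}_{(p)}$. *)
have -> : 2 * S + P * ((m%:R - y - m%:R) / m.+1%:R)
    - 2 ^+ m.+1 * (1 - (T + y / m.+1%:R / 2 ^+ m.+1))
  = 2 * (S - 2 ^+ m * (1 - T)) - (P - 1) * (y / m.+1%:R).
  have h2 : 2 ^+ m.+1 != 0 :> rat by rewrite expf_neq0.
  rewrite exprS in h2 *; have := natS_neq0 m.
  move: (m.+1%:R : rat) (m%:R : rat) (2 ^+ m) h2 => u v w.
  rewrite mulf_eq0 negb_or => /andP[_ w0] u0.
  by field; rewrite u0.
apply: rpredB; first by apply: ZpowMl => //; apply: rpred_nat.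
apply: (@ZpowM _ 1 1); last exact: h.
by apply: one_mod_prod => // t tm; rewrite addrAC subrr add0r rpredN; apply/h/ltnW.
Qed.

(** * Sums of reciprocals of binomial coefficients *)

(** Since $1/((M+1)\binom{M}{i})=\int_0^1 x^i(1-x)^{M-i}\,dx$, this is the integral form of
    $1=(1-x)+x$; the proof is purely algebraic. *)
Lemma inv_bin_split M i : (i <= M)%N ->
  ((M.+1 * 'C(M, i))%:R)^-1 =
  ((M.+2 * 'C(M.+1, i))%:R)^-1 + ((M.+2 * 'C(M.+1, i.+1))%:R)^-1 :> rat.
Proof.
move=> iM; have := mul_bin_diag M.+1 i; have := mul_bin_down M.+1 i => /=.
have c0 : 'C(M, i)%:R != 0 :> rat by rewrite pnatr_eq0 -lt0n bin_gt0.
have c1 : 'C(M.+1, i)%:R != 0 :> rat by rewrite pnatr_eq0 -lt0n bin_gt0 leqW.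
have c2 : 'C(M.+1, i.+1)%:R != 0 :> rat by rewrite pnatr_eq0 -lt0n bin_gt0.
move=> /(congr1 (fun n => n%:R : rat)); rewrite !natrM natrB ?leqW // => e1.
move=> /(congr1 (fun n => n%:R : rat)); rewrite !natrM => e2.
have h1 := natS_neq0 M; have h2 := natS_neq0 M.+1; have h3 := natS_neq0 i.
have h4 : M.+1%:R - i%:R != 0 :> rat.
  by rewrite -natrB ?leqW // pnatr_eq0 subn_eq0 -ltnNge.
have -> : 'C(M.+1, i)%:R = M.+1%:R * 'C(M, i)%:R / (M.+1%:R - i%:R) :> rat.
  by rewrite e1 mulrAC divff // mul1r.
have -> : 'C(M.+1, i.+1)%:R = M.+1%:R * 'C(M, i)%:R / i.+1%:R :> rat.
  by rewrite e2 mulrAC divff // mul1r.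
move: h1 h2 h3 h4; rewrite -!natr1 => h1 h2 h3 h4.
by field; rewrite c0 h1 h2 h3 h4.
Qed.

(** Splitting every term yields each term of the next sum twice, except the two end terms $1/(M+2)$,
    which occur once; this gives a first-order recurrence. *)
Lemma inv_bin_sum m :
  2 ^+ m * \sum_(0 <= i < m) ((m * 'C(m.-1, i))%:R)^-1 =
  \sum_(0 <= j < m) 2 ^+ j.+1 / j.+1%:R :> rat.
Proof.
elim: m => [|[_|M IH]]; first by rewrite !big_nil mulr0.
  by rewrite !big_nat1 bin0 muln1.
rewrite [RHS]big_nat_recr //= -IH /=.
have -> : \sum_(0 <= i < M.+1) ((M.+1 * 'C(M, i))%:R)^-1 =
    2 * (\sum_(0 <= i < M.+2) ((M.+2 * 'C(M.+1, i))%:R)^-1 - M.+2%:R^-1) :> rat.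
  rewrite big_nat; under eq_bigr => i iM do rewrite inv_bin_split //.
  rewrite -big_nat big_split /= mulr_natl mulr2n; congr (_ + _).
    by rewrite [in RHS]big_nat_recr //= binn muln1 addrK.
  by rewrite [in RHS]big_nat_recl //= bin0 muln1 addrAC subrr add0r.
move: (\sum_(0 <= i < M.+2) _) (M.+2%:R^-1 : rat) => q v; rewrite !exprS; ring.
Qed.

(** For odd [m] the first [uphalf m] terms include the middle one, so doubling counts it once too
    often. *)
Lemma sum_sym_half (m : nat) (f : nat -> rat) :
  (forall i, (i < m)%N -> f (m.-1 - i)%N = f i) ->
  \sum_(0 <= i < m) f i =
    2 * \sum_(0 <= i < uphalf m) f i - (odd m)%:R * f m./2.
Proof.
move=> fs.
have e : \sum_(0 <= i < m) f i = \sum_(0 <= i < uphalf m) f i + \sum_(0 <= i < m./2) f i.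
  rewrite (big_cat_nat (n := uphalf m)) //=; last by lia.
  congr (_ + _); rewrite -{1}[uphalf m]add0n big_addn (_ : (m - uphalf m = m./2)%N); last by lia.
  rewrite big_nat_rev /= !big_nat; apply: eq_bigr => i im.
  rewrite -fs; last by lia.
  congr (f _); lia.
rewrite e uphalf_half; case: (odd m) => /=.
  rewrite add1n big_nat_recr //=; ring.
rewrite add0n; ring.
Qed.

(** * Valuations of factorials and binomial coefficients *)

(** The added terms vanish; a common bound [B] allows Legendre's formulas for several factorials to
    be compared term by term. *)
Lemma logn_fact_ext (p n B : nat) : prime p -> (n <= B)%N ->
  logn p n`! = (\sum_(1 <= k < B.+1) n %/ p ^ k)%N.
Proof.
move=> pp nB; have z : (\sum_(n.+1 <= k < B.+1) n %/ p ^ k = 0)%N.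
  rewrite big_nat big1 // => k /andP[nk _].
  by rewrite divn_small // (leq_trans nk) // ltnW // ltn_expl // prime_gt1.
by rewrite logn_fact // [RHS](big_cat_nat (n := n.+1)) //= z addn0.
Qed.

(** By Legendre's formula each $k$ contributes a carry, 0 or 1. There is none for $k<c$ by
    hypothesis, and none for $k\ge a$ because $N<p^a$. *)
Lemma logn_bin_le (p N i a c : nat) : prime p -> (0 < c)%N -> (i <= N)%N -> (N < p ^ a)%N ->
  (forall k, (0 < k < c)%N -> (N %/ p ^ k <= i %/ p ^ k + (N - i) %/ p ^ k)%N) ->
  (logn p 'C(N, i) <= a - c)%N.
Proof.
move=> pp c0 iN Na h.
have := congr1 (logn p) (bin_fact iN).
rewrite !lognM ?muln_gt0 ?fact_gt0 ?bin_gt0 ?iN // !(@logn_fact_ext p _ N) ?leq_subr //.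
have ind B : (\sum_(1 <= k < B.+1) (c <= k < a) <= minn a B.+1 - c)%N.
  elim: B => [|B IH]; first by rewrite big_geq.
  by rewrite big_nat_recr //=; lia.
have : (\sum_(1 <= k < N.+1) N %/ p ^ k <= \sum_(1 <= k < N.+1) i %/ p ^ k
   + \sum_(1 <= k < N.+1) (N - i) %/ p ^ k + \sum_(1 <= k < N.+1) (c <= k < a))%N.
  rewrite -!big_split /= !big_nat; apply: leq_sum => k /andP[k0 _].
  have [kc|ck] := ltnP k c; first by rewrite (leq_trans (h k _)) ?k0 ?leq_addr.
  have [ka|ak] := ltnP k a.
    rewrite -{1}(subnKC iN) divnD ?expn_gt0 ?prime_gt0 // leq_add2l; exact: leq_b1.
  rewrite divn_small // (leq_trans Na) // leq_exp2l ?prime_gt1 //.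
have := ind N; lia.
Qed.

(** * Euler's criterion, for primes and prime powers *)

Lemma Fp_int_eq0 (p : nat) (x : int) : prime p -> (x%:~R == 0 :> 'F_p) = (p %| x)%Z.
Proof.
by move=> pp; rewrite (dvdz_pcharf (pchar_Fp pp)). Qed.

Lemma Fp_fermat (p : nat) (x : 'F_p) : prime p -> x ^+ p = x.
Proof. by move=> pp; have := expf_card x; rewrite card_Fp. Qed.

Lemma euler_criterion (p : nat) (x : int) : prime p -> odd p ->
  (x%:~R : 'F_p) ^+ p./2 = (legendre x p)%:~R.
Proof.
move=> pp op; rewrite /legendre.
have p1 := prime_gt1 pp.
have h0 : (0 < p./2)%N by lia.
have pE : p = (p./2 * 2).+1 by lia.
have [dx|ndx] := boolP (p %| x)%Z.
  by move: dx; rewrite -Fp_int_eq0 // => /eqP ->; rewrite expr0n eqn0Ngt h0.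
set z : 'F_p := x%:~R; have z0 : z != 0 by rewrite Fp_int_eq0.
have sq1 (y : 'F_p) : y != 0 -> (y ^+ p./2) ^+ 2 = 1.
  by move=> y0; apply: (mulfI y0); rewrite -exprM -exprS -pE Fp_fermat // mulr1.
have sqE (y : nat) : (y%:Z ^+ 2 == x %[mod p])%Z = (y%:R ^+ 2 == z).
  by rewrite eqz_mod_dvd -Fp_int_eq0 // rmorphB rmorphXn /= subr_eq0.
case: existsP => [[y]|nqr].
  rewrite sqE => /eqP ze; rewrite -ze exprAC sq1 //.
  by apply: contraNneq z0 => y0; rewrite -ze y0 expr0n.
have /eqP := sq1 _ z0; rewrite sqrf_eq1 => /orP[/eqP zh|/eqP -> //].
(* Otherwise 'X^(p./2) - 1 has, besides x, the p./2 nonzero squares as roots. *)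
pose q : {poly 'F_p} := 'X^(p./2) - 1.
pose rs : seq 'F_p := z :: [seq i.+1%:R ^+ 2 | i <- iota 0 p./2].
have q0 : q != 0 by rewrite -size_poly_eq0 size_XnsubC.
have inj (i : nat) : (0 < i < p)%N -> i%:R != 0 :> 'F_p.
  move=> ip; have := Fp_int_eq0 i pp; rewrite -pmulrn => ->.
  rewrite dvdzE /= gtnNdvd //; lia.
have rq : all (root q) rs.
  apply/allP => y; rewrite inE => /orP[/eqP ->|/mapP[i]].
    by rewrite rootE !hornerE zh subrr.
  rewrite mem_iota => ip ->; rewrite rootE !hornerE exprAC sq1 ?subrr // inj //; lia.
have uq : uniq rs.
  rewrite /= map_inj_in_uniq ?iota_uniq ?andbT; last first.
    move=> i j; rewrite !mem_iota => ip jp /eqP; rewrite eqf_sqr => /orP[|].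
      wlog ij : i j ip jp / (i <= j)%N.
        move=> w; case: (leqP i j) => [|/ltnW] ij e; first exact: w.
        by apply/esym; move: e; rewrite eq_sym; apply: w.
      rewrite eq_sym -subr_eq0 -natrB ?ltnS // subSS => e.
      apply/eqP; rewrite eqn_leq ij /= -subn_eq0; apply: contraTT e => ij0; apply: inj; lia.
    (* Opposite roots are excluded because the sum of the two indices lies strictly between 0 and
       $p$. *)
    rewrite -addr_eq0 -natrD => e; exfalso; move: e; apply/negP/inj; lia.
  apply/mapP => -[i]; rewrite mem_iota => ip e; case: nqr.
  have ip' : (i.+1 < p)%N by lia.
  by exists (Ordinal ip'); rewrite sqE /= e.
by have := max_poly_roots q0 rq uq; rewrite size_XnsubC //= size_map size_iota ltnn.
Qed.

Lemma jacobi_pfactor (p a : nat) (x : int) : prime p -> (0 < a)%N ->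
  jacobi x (p ^ a) = legendre x p ^+ a.
Proof.
move=> pp a0; rewrite /jacobi prime_decompE primesX // primes_prime //=.
by rewrite big_seq1 /= pfactorK.
Qed.

(** Induction through $(p^{a+1}-1)/2=p\,(p^a-1)/2+(p-1)/2$, as raising to the power $p$ is the
    identity on $\mathbb{F}_p$. *)
Lemma euler_criterion_jacobi (p a : nat) (x : int) : prime p -> odd p -> (0 < a)%N ->
  (x%:~R : 'F_p) ^+ (p ^ a)./2 = (jacobi x (p ^ a))%:~R.
Proof.
move=> pp op a0; rewrite jacobi_pfactor //; case: a a0 => // a _.
elim: a => [|a IH]; first by rewrite expr1; apply: euler_criterion.
have -> : (p ^ a.+2)./2 = (p ^ a.+1)./2 * p + p./2 :> nat.
  have : odd (p ^ a.+1) by rewrite oddX op orbT.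
  by rewrite (expnS p a.+1); move: (p ^ _)%N => q oq; nia.
by rewrite exprD exprM Fp_fermat // IH euler_criterion // [in RHS]exprSr rmorphM.
Qed.

Lemma two_pow_half (p a : nat) : prime p -> odd p -> (0 < a)%N ->
  2 ^+ (p ^ a)./2 - (jacobi 2 (p ^ a))%:~R \in Zpow p 1.
Proof.
move=> pp op a0.
have -> : 2 ^+ (p ^ a)./2 - (jacobi 2 (p ^ a))%:~R
   = (2 ^+ (p ^ a)./2 - jacobi 2 (p ^ a))%:~R :> rat by rewrite rmorphB rmorphXn.
apply: Zpow_int; rewrite ?prime_gt0 // -Fp_int_eq0 // rmorphB rmorphXn /= subr_eq0.
by apply/eqP/euler_criterion_jacobi.
Qed.

Lemma jacobi2_sqr (p a : nat) : prime p -> odd p -> (0 < a)%N ->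
  jacobi 2 (p ^ a) ^+ 2 = 1.
Proof.
move=> pp op a0; rewrite jacobi_pfactor // exprAC /legendre.
have /negPf -> : ~~ (p %| 2%:Z)%Z.
  by rewrite dvdzE /= dvdn_prime2 //; apply: contraTneq op => ->.
by case: ifP; rewrite ?expr1n // sqrrN !expr1n.
Qed.

(** * Divisibility and congruences for $n=p^a$ and $m=(n-1)/2$ *)

Lemma logn_lt_exp (p a t : nat) : prime p -> (0 < t < p ^ a)%N -> (logn p t < a)%N.
Proof.
move=> pp /andP[t0 ta]; rewrite -(ltn_exp2l _ _ (prime_gt1 pp)).
by apply: leq_ltn_trans ta; apply: dvdn_leq (pfactor_dvdnn p t).
Qed.

Lemma Zpow_exp_div (p a t : nat) : prime p -> (0 < t < p ^ a)%N ->
  (p ^ a)%:R / t%:R \in Zpow p 1.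
Proof.
move=> pp ta; have /andP[t0 _] := ta.
by apply: Zpow_invn; rewrite // addn1 logn_lt_exp.
Qed.

(** Only the binomial coefficient can lose factors $p$, since $m$ is prime to $p$. The carry
    condition is vacuous for $c=1$; for $c=2$ it concerns the lowest digit alone. *)
Lemma Zpow_exp_div_bin (p a i c : nat) : prime p -> (0 < c <= a)%N -> odd (p ^ a) ->
  (i < (p ^ a)./2)%N ->
  (forall k, (0 < k < c)%N -> ((p ^ a)./2.-1 %/ p ^ k <=
     i %/ p ^ k + ((p ^ a)./2.-1 - i) %/ p ^ k)%N) ->
  (p ^ a)%:R / ((p ^ a)./2 * 'C((p ^ a)./2.-1, i))%:R \in Zpow p c.
Proof.
move=> pp /andP[c0 ca] on im h; set m := (p ^ a)./2 in im h *.
have a0 := leq_trans c0 ca.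
have c1 : (0 < 'C(m.-1, i))%N by rewrite bin_gt0; lia.
apply: Zpow_invn => //; first by rewrite muln_gt0 c1; lia.
have lm : logn p m = 0%N.
  apply/eqP; rewrite -leqn0 leqNgt; apply/negP => l0.
  (* A common divisor $p$ of $m$ and $n=2m+1$ would divide 1. *)
  have pm : (p %| m)%N by move: l0; rewrite logn_gt0 mem_primes => /and3P[].
  have pn : (p %| p ^ a)%N by rewrite dvdn_exp.
  have : (p %| 1)%N.
    rewrite -(@dvdn_addl (m * 2) p 1) ?dvdn_mulr //.
    by have -> : (1 + m * 2 = p ^ a)%N by rewrite /m; lia.
  by rewrite dvdn1 => /eqP p1; move: pp; rewrite p1.
rewrite lognM //; last by lia.
have := @logn_bin_le p m.-1 i a c pp c0.
rewrite lm add0n => hh; have := hh _ _ h; rewrite -ltnS; move=> {}hh.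
have : (logn p 'C(m.-1, i) <= a - c)%N by rewrite -ltnS; apply: hh; lia.
lia.
Qed.

(** The two terms differ by an exact factor $r\in 1+p\mathbb{Z}_{(p)}$, and the second already lies
    in $p\mathbb{Z}_{(p)}$, so their difference lies in $p^2\mathbb{Z}_{(p)}$. *)
Lemma gbinom_half_tail (p a i : nat) : prime p -> odd p -> (0 < a)%N ->
  (i < (p ^ a)./2)%N ->
  gbinom (- (1 / 2)) ((p ^ a)./2.+1 + i)
    - 2^-1 * ((p ^ a)%:R / ((p ^ a)./2 * 'C((p ^ a)./2.-1, i))%:R) \in Zpow p 2.
Proof.
move=> pp op a0 im.
have on : odd (p ^ a) by rewrite oddX op orbT.
set n := (p ^ a)%N in on im *; set m := n./2 in im *.
have nE : n = m.*2.+1 by rewrite /m; lia.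
have nR : n%:R = 2 * m%:R + 1 :> rat by rewrite nE -natr1 -mul2n natrM.
have p0 := prime_gt0 pp.
have half := Zloc_half op.
have zn t : (0 < t < n)%N -> n%:R / t%:R \in Zpow p 1 by apply: Zpow_exp_div.
have zy t : (0 < t < n)%N -> n%:R / 2 / t%:R \in Zpow p 1.
  by move=> tn; rewrite mulrAC; apply: ZpowMr => //; apply: zn.
have [r r1 ->] : exists2 r, r - 1 \in Zpow p 1 &
    gbinom (- (1 / 2)) (m.+1 + i) = 2^-1 * (n%:R / (m * 'C(m.-1, i))%:R) * r.
  (* Consecutive terms on both sides have the same ratio up to a factor in 1 + p Z_(p). *)
  elim: i im => [|i IH] im.
    (* The product is $\binom{-1/2}{m}$; the last factor equals $-m/(m+1)$ because $m+1-n=-m$. *)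
    exists ((\prod_(0 <= t < m) (1 - n%:R / 2 / t.+1%:R)) * (1 - n%:R / m.+1%:R)).
      apply: one_modM => //; last first.
        by rewrite addrAC subrr add0r rpredN; apply: zn; lia.
      apply: one_mod_prod => // t tm.
      by rewrite addrAC subrr add0r rpredN; apply: zy; lia.
    rewrite addn0 gbinomS (_ : - (1 / 2) = m%:R - n%:R / 2); last first.
      by rewrite nR; field.
    rewrite gbinom_shift_diag bin0 muln1; move: (\prod_(_ <= _ < _) _) => P.
    have m0 : m%:R != 0 :> rat by rewrite pnatr_eq0; lia.
    have := natS_neq0 m; rewrite -natr1 nR => m1.
    by field; rewrite m0 m1.
  have [r r1 e] := IH (ltnW im).
  (* With $k=m+1+i$, the new factors come from $-1/2-k=-(i+1+n/2)$ and $k+1-n=-(m-1-i)$. *)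
  exists (r * ((1 + n%:R / 2 / i.+1%:R) * (1 - n%:R / (m.+1 + i).+1%:R))).
    apply: one_modM => //; apply: one_modM => //.
      by rewrite addrAC subrr add0r; apply: zy; lia.
    by rewrite addrAC subrr add0r rpredN; apply: zn; lia.
  rewrite addnS gbinomS e.
  have cE : i.+1%:R * 'C(m.-1, i.+1)%:R = (m.-1 - i)%N%:R * 'C(m.-1, i)%:R :> rat.
    by rewrite -!natrM mul_bin_left.
  have c1 : 'C(m.-1, i)%:R != 0 :> rat by rewrite pnatr_eq0 -lt0n bin_gt0; lia.
  have d0 : (m.-1 - i)%N%:R != 0 :> rat by rewrite pnatr_eq0; lia.
  have dE : (m.-1 - i)%N%:R = m%:R - i%:R - 1 :> rat.
    by rewrite natrB -?subn1 ?natrB; [ring|lia..].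
  have i1 := natS_neq0 i; have k1 := natS_neq0 (m.+1 + i).
  have m0 : m%:R != 0 :> rat by rewrite pnatr_eq0; lia.
  rewrite !natrM.
  have -> : 'C(m.-1, i.+1)%:R = (m.-1 - i)%N%:R * 'C(m.-1, i)%:R / i.+1%:R :> rat.
    by rewrite -cE mulrAC divff // mul1r.
  have lE : (m.+1 + i)%:R = m%:R + i%:R + 1 :> rat by rewrite addSn -natr1 natrD.
  move: i1 k1 d0; rewrite dE -[(m.+1 + i).+1%:R]natr1 lE -[i.+1%:R]natr1 nR => i1 k1 d0.
  by field; rewrite c1 d0 m0 i1 k1.
set w := 2^-1 * _; have -> : w * r - w = w * (r - 1) by ring.
apply: (@ZpowM _ 1 1) => //; apply: ZpowMl => //.
by apply: Zpow_exp_div_bin => // k; lia.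
Qed.

Lemma gbinom_m1 k : gbinom (-1) k = (-1) ^+ k.
Proof.
elim: k => [|k IH]; first by rewrite gbinom0.
have := natS_neq0 k; rewrite gbinomS IH exprSr -natr1 => h.
by congr (_ * _); field.
Qed.

Lemma sum_sign m : \sum_(0 <= k < m.*2.+1) (-1) ^+ k = 1 :> rat.
Proof.
elim: m => [|m IH]; first by rewrite big_nat1.
by rewrite doubleS big_nat_recr //= big_nat_recr //= IH !exprS -mul2n exprM sqrrN !expr1n; ring.
Qed.

(** In the evaluation at $y=n$, $M=2m$, the indices above $m$ are folded back by $s\mapsto n-s$,
    where $2^{2m}/2^{n-s}=2^{s-1}$. *)
Lemma harmonic_pow2_mod (p a : nat) : prime p -> odd p -> (0 < a)%N ->
  1 - 2 ^+ (p ^ a)./2 ^+ 2 *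
      (1 - \sum_(0 <= j < (p ^ a)./2) (p ^ a)%:R / j.+1%:R / 2 ^+ j.+1)
    - \sum_(0 <= j < (p ^ a)./2) (p ^ a)%:R / j.+1%:R * 2 ^+ j \in Zpow p 2.
Proof.
move=> pp op a0; set n := (p ^ a)%N; set m := n./2; have p0 := prime_gt0 pp.
have on : odd n by rewrite oddX op orbT.
have nE : n = m.*2.+1 by rewrite /m; lia.
have nR : n%:R = m.*2%:R + 1 :> rat by rewrite nE natr1.
have zn t : (0 < t < n)%N -> n%:R / t%:R \in Zpow p 1 by apply: Zpow_exp_div.
have := @gbinom_partial_sum_mod p m.*2 n%:R p0 (fun t tm => zn t.+1 ltac:(lia)).
rewrite {1}nR opprD addrA subrr add0r.
under eq_bigr => k _ do rewrite gbinom_m1.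
rewrite sum_sign (big_cat_nat (n := m)) //=; last by lia.
set A := \sum_(0 <= j < m) _; set B := \sum_(m <= j < _) _; set C := \sum_(_ <= _ < _) _.
have -> : 2 ^+ m.*2 = 2 ^+ m ^+ 2 :> rat by rewrite -muln2 exprM.
move=> h.
have hC : 2 ^+ m ^+ 2 * B + C \in Zpow p 2.
  have -> : B = \sum_(0 <= i < m) n%:R / (i + m).+1%:R / 2 ^+ (i + m).+1.
    by rewrite /B -{1}[m]add0n big_addn (_ : (m.*2 - m = m)%N); last by lia.
  rewrite big_nat_rev /= /C mulr_sumr -big_split /= big_nat; apply: rpred_sum => i /= im.
  have -> : (0 + m - i.+1 + m).+1 = (n - i.+1)%N by lia.
  have e : 2 ^+ m ^+ 2 = 2 ^+ i * 2 ^+ (n - i.+1) :> rat.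
    by rewrite -exprM -exprD; congr (_ ^+ _); lia.
  have t0 := natS_neq0 i; have s0 : (n - i.+1)%:R != 0 :> rat by rewrite pnatr_eq0; lia.
  have sE : (n - i.+1)%:R = n%:R - i.+1%:R :> rat by rewrite natrB //; lia.
  (* Here $n/(n-s)+n/s=(n/s)(n/(n-s))$ with $s=i+1$, so both factors lie in $p\mathbb{Z}_{(p)}$. *)
  have -> : 2 ^+ m ^+ 2 * (n%:R / (n - i.+1)%:R / 2 ^+ (n - i.+1)) + n%:R / i.+1%:R * 2 ^+ i
    = 2 ^+ i * (n%:R / i.+1%:R * (n%:R / (n - i.+1)%:R)) :> rat.
    have : 2 ^+ (n - i.+1) != 0 :> rat by rewrite expf_neq0.
    rewrite e; move: s0 (_ ^+ (n - _)) => /[swap] u; rewrite sE => s0 u0.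
    by field; rewrite nat1r u0 s0 t0.
  apply: ZpowMl; first by rewrite rpredX ?rpred_nat.
  by apply: (@ZpowM _ 1 1); apply: zn; lia.
have -> : 1 - 2 ^+ m ^+ 2 * (1 - A) - C
   = (1 - 2 ^+ m ^+ 2 * (1 - (A + B))) - (2 ^+ m ^+ 2 * B + C) by ring.
exact: rpredB.
Qed.

(** For odd $m$ one has $n\equiv 3\pmod 4$, hence $p\equiv 3\pmod 4$ and $a>1$. It remains to see
    that halving $m-1$ produces no carry at the lowest digit in base $p$. *)
Lemma middle_term_mod (p a : nat) : prime p -> odd p -> (0 < a)%N ->
  (p = 1 %[mod 4])%N \/ (1 < a)%N -> odd (p ^ a)./2 ->
  (p ^ a)%:R / ((p ^ a)./2 * 'C((p ^ a)./2.-1, (p ^ a)./2./2))%:R \in Zpow p 2.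
Proof.
move=> pp op a0 hpa; set n := (p ^ a)%N; set m := n./2 => om.
have on : odd n by rewrite oddX op orbT.
have n4 : (n %% 4 = 3)%N by move: om on; rewrite /m; lia.
have p4 : (p %% 4 = 3)%N.
  have : (p %% 4 != 1)%N.
    by apply: contra_eqN n4 => /eqP p4; rewrite /n -modnXm p4 exp1n.
  by lia.
have a1 : (1 < a)%N by case: hpa => //; rewrite p4.
have [s sE] : exists s, n = (s * p)%N.
  by exists (p ^ a.-1)%N; rewrite -expnSr prednK.
apply: Zpow_exp_div_bin => //; first by rewrite -/n -/m; lia.
rewrite -/n -/m => k k2; have -> : k = 1%N by lia.
rewrite expn1.
have -> : (m.-1 - m./2 = m./2)%N by lia.
have -> : (m.-1 = m./2 + m./2)%N by lia.
have p0 := prime_gt0 pp.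
rewrite divnD // -[leqRHS]addn0 leq_add2l leqn0 eqb0 -ltnNge.
(* If r is the remainder of m./2 modulo p, then 4 r + 3 = c p with c = 1, so that adding
   m./2 to itself in base p produces no carry at the lowest digit. *)
have rE : (m./2 * 4 + 3 = s * p)%N by rewrite -sE; move: om on; rewrite /m; lia.
have := divn_eq m./2 p; have := ltn_pmod m./2 p0.
move: (m./2 %/ p)%N (m./2 %% p)%N => q r rp qE.
have : (4 * r + 3 = (s - 4 * q) * p)%N by rewrite mulnBl -rE qE; nia.
move: (s - 4 * q)%N => c cE.
have c4 : (c < 4)%N.
  by rewrite ltnNge; apply/negP => c4; have := leq_mul c4 (leqnn p); lia.
(* Even [c] fails by parity and [c = 3] fails modulo 4; [c = 1] gives $2r<p$. *)
by move: cE; case: c c4 => [|[|[|[|]]]] // _; lia.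
Qed.

(** * Assembly of the two halves of the sum *)

Theorem theorem1p1 (p a : nat) (p_prime : prime p) (p_odd : odd p)
    (a_gt0 : (0 < a)%N) (hpa : (p = 1 %[mod 4])%N \/ (1 < a)%N) :
  eqmod_Zloc p 2
    (\sum_(0 <= k < ((3 * p ^ a) %/ 4).+1) gbinom (- (1 / 2)) k)%R
    ((jacobi 2 (p ^ a))%:~R)%R.
Proof.
have p0 := prime_gt0 p_prime; apply: ZpowP => //.
have half := Zloc_half p_odd.
have := two_pow_half p_prime p_odd a_gt0.
have := harmonic_pow2_mod p_prime p_odd a_gt0.
have := middle_term_mod p_prime p_odd a_gt0 hpa.
have := gbinom_half_tail p_prime p_odd a_gt0.
have zn t : (0 < t < p ^ a)%N -> (p ^ a)%:R / t%:R \in Zpow p 1 by apply: Zpow_exp_div.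
have : odd (p ^ a) by rewrite oddX p_odd orbT.
move: (jacobi2_sqr p_prime p_odd a_gt0) zn; set n := (p ^ a)%N;
set m := n./2 => e2 zn on tail mid harm D1.
have nE : n = m.*2.+1 by rewrite /m; lia.
have nR : n%:R = 2 * m%:R + 1 :> rat by rewrite nE -natr1 -mul2n natrM.
rewrite (big_cat_nat (n := m.+1)) //=; last by lia.
have := @gbinom_partial_sum_mod p m (n%:R / 2) p0.
set S1 := \sum_(0 <= k < m.+1) _ => hS1.
have -> : \sum_(0 <= k < m.+1) gbinom (- (1 / 2)) k = S1.
  rewrite /S1 (_ : - (1 / 2) = m%:R - n%:R / 2) // nR; by field.
have {}hS1 := hS1 (fun t tm => ltac:(rewrite mulrAC; apply: ZpowMr => //; apply: zn; lia)).
pose f i : rat := n%:R / (m * 'C(m.-1, i))%:R.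
pose F : rat := \sum_(0 <= i < m) f i; pose T : rat := \sum_(0 <= i < uphalf m) f i.
pose M : rat := (odd m)%:R * f m./2.
pose A : rat := \sum_(0 <= j < m) n%:R / j.+1%:R / 2 ^+ j.+1.
pose C : rat := \sum_(0 <= j < m) n%:R / j.+1%:R * 2 ^+ j.
set S2 := \sum_(m.+1 <= k < _) _.
have hS2 : S2 - 2^-1 * T \in Zpow p 2.
  (* The tail has $\lfloor 3n/4\rfloor-m=\lceil m/2\rceil$ terms, so it includes the middle one when
     $m$ is odd. *)
  rewrite /S2 -{1}[m.+1]add0n big_addn (_ : (_ - m.+1 = uphalf m)%N); last first.
    by clear -on nE; lia.
  rewrite mulr_sumr -sumrB big_nat; apply: rpred_sum => i /= im.
  by rewrite addnC; apply: tail; clear -im; lia.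
have FE : F = 2 * T - M.
  apply: sum_sym_half => i im; rewrite /f -bin_sub; last by clear -im; lia.
  by congr (_ / (_ * 'C(_, _))%:R); clear -im; lia.
have hM : M \in Zpow p 2.
  rewrite /M; case: (boolP (odd m)) => om; rewrite ?mul0r ?rpred0 // mul1r.
  exact: mid.
have XF : 2 ^+ m * F = 2 * C.
  transitivity (2 ^+ m * (n%:R * \sum_(0 <= i < m) ((m * 'C(m.-1, i))%:R)^-1) : rat).
    by congr (_ * _); rewrite mulr_sumr.
  rewrite mulrCA inv_bin_sum /C !mulr_sumr; apply: eq_bigr => j _.
  by rewrite exprS; ring.
have A2 : \sum_(0 <= j < m) n%:R / 2 / j.+1%:R / 2 ^+ j.+1 = 2^-1 * A.
  by rewrite mulr_sumr; apply: eq_bigr => j _; ring.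
have X0 : 2 ^+ m != 0 :> rat by rewrite expf_neq0.
have XZ : 2 ^+ m \in Zloc p by rewrite rpredX ?rpred_nat.
have XV : (2 ^+ m)^-1 \in Zloc p by rewrite -exprVn rpredX.
have e1 : (jacobi 2 n)%:~R ^+ 2 = 1 :> rat by rewrite -rmorphXn /= e2.
rewrite -/A -/C in harm; rewrite A2 in hS1.
clearbody A C F T M S1 S2; clear e2.
move: (2 ^+ m) ((jacobi 2 n)%:~R) => X e in hS1 harm D1 XF X0 XZ XV e1 *.
(* Writing 1 as [e ^+ 2] lets the remaining terms complete the square of [X - e]. *)
have {}harm : e ^+ 2 - X ^+ 2 * (1 - A) - C \in Zpow p 2 by rewrite e1.
have CE : C = 2^-1 * (X * (2 * T - M)) by rewrite -FE XF mulKf.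
(* Up to errors in p ^ 2 Z_(p), X (S1 + S2 - e) is (X - e) ^ 2 / 2. *)
have -> : S1 + S2 - e = X^-1 * (X * (S1 - X * (1 - 2^-1 * A)) + X * (S2 - 2^-1 * T)
    + 2^-1 * (X * (2^-1 * M))
    - 2^-1 * (e ^+ 2 - X ^+ 2 * (1 - A) - C) + 2^-1 * ((X - e) * (X - e))).
  by rewrite CE; field.
have D2 : (X - e) * (X - e) \in Zpow p 2 by apply: (@ZpowM _ 1 1).
apply: ZpowMl => //; apply: rpredD; last exact: ZpowMl.
apply: rpredB; last exact: ZpowMl.
apply: rpredD; last by do 3!apply: ZpowMl => //.
by apply: rpredD; apply: ZpowMl.
Qed.
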